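(* Let $A$ be the standard Podleś quantum 2-sphere over $k=\mathbb{C}$ with $q\in k\setminus\{0\}$ not a root of unity. Let $\lambda\in k\setminus\{0\}$. The cap product action of the twisted centre $\Lambda^0_G(A)=k[x_0]$ on $H_0(A,{}_{\sigma_\lambda}A)$ is determined by the following formulas for $\frown x_0:H_0(A,{}_{\sigma_\lambda}A)\to H_0(A,{}_{\sigma_{q^2\lambda}}A)$: $$[x_{\pm1}^j]\frown x_0=0\quad\text{for } j>0,$$ $$[x_0^i]\frown x_0=[x_0^{i+1}]\quad\text{for } i\ge0,$$ where in $H_0(A,{}_{\sigma_{q^2\lambda}}A)$ one has $$[x_0^{i+1}]=\begin{cases}0 & \text{if } i=0 \text{ and } \lambda=q^{2m} \text{ for some integer } m>0,\\[1mm] -q\,\dfrac{1-\lambda}{q^2-\lambda}\,[x_0] & \text{if } i=1 \text{ and } \lambda\ne q^2.\end{cases}$$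
   Context: $A$ is the universal unital $k$-algebra generated by $x_{-1},x_0,x_1$ with relations $x_{\pm1}x_0=q^{\mp2}x_0x_{\pm1}$, $x_{\pm1}x_{\mp1}=q^{\mp2}x_0^2+q^{\mp1}x_0$. $G=\mathrm{Aut}(A)$, and for $\lambda\in k\setminus\{0\}$, $\sigma_\lambda\in G$ is the automorphism with $\sigma_\lambda(x_n)=\lambda^nx_n$; put $\sigma_{\mathrm{mod}}=\sigma_{q^2}$. For $\sigma\in G$, $H_0(A,{}_\sigma A)$ is the quotient of the vector space $A$ by the span of all elements $ab-\sigma(b)a$, $a,b\in A$; $[a]$ denotes the class of $a\in A$. The twisted centre is $\Lambda^0_G(A)=\bigoplus_{\sigma\in G}H^0(A,{}_\sigma A)$ with $H^0(A,{}_\sigma A)=\{a\in A\mid ab=\sigma(b)a\ \forall b\in A\}$; it is the algebra $k[x_0]$ generated by $x_0\in H^0(A,{}_{\sigma_{\mathrm{mod}}}A)$. For $c\in H^0(A,{}_\tau A)$ the cap product $H_0(A,{}_\sigma A)\to H_0(A,{}_{\tau\circ\sigma}A)$ is $[a]\frown c=[ca]$. A vector space basis of $H_0(A,{}_{\sigma_\lambda}A)$ is: $[1]$; together with all $[x_{\pm1}^j]$, $j>0$, if $\lambda=1$; together with $[x_0]$ if $\lambda\neq q^{2i}$ for all integers $i>0$; together with $[x_0^i]$ if $\lambda=q^{2i}$ with $i>0$. *)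

(* Defs.v *)
From HB Require Import structures.
From mathcomp Require Import all_boot all_order all_algebra.
From mathcomp Require Import boolp reals complex.
From mathcomp.multinomials Require Import monalg.

Set Implicit Arguments.
Unset Strict Implicit.
Unset Printing Implicit Defensive.

Import GRing.Theory.
Local Open Scope ring_scope.
Local Open Scope quotient_scope.

(* lquot P is the vector space V / lspan P, also when infinite dimensional.   *)
Section LinearQuotient.
Variables (k : fieldType) (V : lmodType k) (P : V -> Prop).

Definition lspan : {pred V} := fun v =>
  `[< exists s : seq (k * V),
        (forall t, t \in s -> P t.2) /\ v = \sum_(t <- s) t.1 *: t.2 >].

Lemma lspan_submod_closed : submod_closed lspan.
Proof.
split=> [|a u v /asboolP[s [sP ->]] /asboolP[r [rP ->]]]; apply/asboolP.
  by exists [::]; rewrite big_nil.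
exists ([seq (a * t.1, t.2) | t <- s] ++ r); split.
  by move=> t; rewrite mem_cat => /orP[/mapP[u' /sP ? ->]|/rP].
rewrite big_cat big_map scaler_sumr; congr (_ + _).
by apply: eq_bigr => t _; rewrite scalerA.
Qed.

HB.instance Definition _ :=
  GRing.isSubmodClosed.Build k V lspan lspan_submod_closed.

Lemma mem_lspan v : P v -> v \in lspan.
Proof.
move=> Pv; apply/asboolP; exists [:: (1, v)].
by rewrite big_seq1 scale1r; split=> // t; rewrite inE => /eqP->.
Qed.

Lemma lspan_ind (Q : V -> Prop) : Q 0 ->
  (forall a u v, P u -> Q v -> Q (a *: u + v)) ->
  forall v, v \in lspan -> Q v.
Proof.
move=> Q0 QD v /asboolP[s [sP ->]]; elim: s sP => [|t s IH] sP.
  by rewrite big_nil.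
rewrite big_cons; apply: QD; first by apply: sP; rewrite mem_head.
by apply: IH => u us; apply: sP; rewrite inE us orbT.
Qed.

Definition lquot := Quotient.quot lspan.

HB.instance Definition _ := GRing.Zmodule.on lquot.

Definition lcls (v : V) : lquot := \pi_(Quotient.quot lspan) v.

Lemma lcls_surj (x : lquot) : lcls (repr x) = x.
Proof. exact: reprK. Qed.

Lemma lcls_eq u v : (lcls u = lcls v) <-> (u - v \in lspan).
Proof. by rewrite Quotient.idealrBE; split=> /eqP. Qed.

Lemma lcls_reprB v : repr (lcls v) - v \in lspan.
Proof. by apply/lcls_eq; rewrite lcls_surj. Qed.

Lemma lcls_zmod_morphism : zmod_morphism lcls.
Proof. by move=> u v; rewrite /lcls raddfB. Qed.

Definition lquot_scale (a : k) (x : lquot) : lquot := lcls (a *: repr x).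

Lemma lcls_scale a v : lcls (a *: v) = lquot_scale a (lcls v).
Proof.
apply/esym/lcls_eq; rewrite -scalerBr.
by apply: rpredZ; apply: lcls_reprB.
Qed.

Lemma lclsD : {morph lcls : u v / u + v}.
Proof. by move=> u v; rewrite /lcls raddfD. Qed.

Fact lquot_scaleA a b x :
  lquot_scale a (lquot_scale b x) = lquot_scale (a * b) x.
Proof. by rewrite -[x]lcls_surj -!lcls_scale scalerA. Qed.

Fact lquot_scale1 : left_id 1 lquot_scale.
Proof. by move=> x; rewrite -[x]lcls_surj -!lcls_scale scale1r. Qed.

Fact lquot_scaleDr : right_distributive lquot_scale +%R.
Proof.
move=> a x y; rewrite -[x]lcls_surj -[y]lcls_surj.
by rewrite -lclsD -!lcls_scale -lclsD scalerDr.
Qed.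

Fact lquot_scaleDl x : {morph lquot_scale^~ x : a b / a + b}.
Proof.
by move=> a b; rewrite -[x]lcls_surj -!lcls_scale -lclsD scalerDl.
Qed.

HB.instance Definition _ := GRing.Zmodule_isLmodule.Build k lquot
  lquot_scaleA lquot_scale1 lquot_scaleDr lquot_scaleDl.

HB.instance Definition _ :=
  GRing.isZmodMorphism.Build V lquot lcls lcls_zmod_morphism.
HB.instance Definition _ :=
  GRing.isScalable.Build k V lquot *:%R lcls lcls_scale.

End LinearQuotient.

Section TwistedHomology.
Variables (k : fieldType) (A : algType k).
Implicit Types (s t r : A -> A) (a b c : A).

Definition is_algaut s : Prop :=
  [/\ linear s, monoid_morphism s & bijective s].

(* c belongs to H^0(A, {}_t A). *)
Definition twcenter t c : Prop := forall b, c * b = t b * c.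

Definition twcomm s (v : A) : Prop := exists a b, v = a * b - s b * a.

(* H_0(A, {}_s A). *)
Definition H0 s := lquot (twcomm s).

HB.instance Definition _ s := GRing.Lmodule.on (H0 s).

Definition cls s : A -> H0 s := @lcls k A (twcomm s).

HB.instance Definition _ s := GRing.Linear.on (cls s).

(* The cap product H_0(A, {}_s A) -> H_0(A, {}_r A) by an element c of        *)
(* H^0(A, {}_t A), where r = t \o s. It is defined on a representative;       *)
(* cap_cls is independence of this choice. The target twist r is a parameter  *)
(* because t \o s is often known under another name, see sigma_comp.          *)
Definition cap s r c (h : H0 s) : H0 r := cls r (c * repr h).

Lemma cls_surj s (h : H0 s) : cls s (repr h) = h.
Proof. exact: lcls_surj. Qed.

Lemma cap_cls s t r c a : twcenter t c -> r = t \o s ->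
  cap r c (cls s a) = cls r (c * a).
Proof.
move=> ct ->; apply/lcls_eq; rewrite -mulrBr.
move: (repr _ - a) (lcls_reprB (twcomm s) a).
apply: lspan_ind => [|x u v [b [d ->]] IH].
  by rewrite mulr0 rpred0.
rewrite mulrDr -scalerAr rpredD ?rpredZ //; apply: mem_lspan.
by exists (c * b), d; rewrite mulrBr !mulrA (ct (s d)).
Qed.

(* Actions of the G-graded algebra of all the H^0(A, {}_t A), t in G = Aut(A),*)
(* on the family of all the H_0(A, {}_s A), s in G, where the component of    *)
(* degree t sends H_0(A, {}_s A) to H_0(A, {}_(t \o s) A).                    *)
Definition twcenter_action
    (act : forall s r, A -> H0 s -> H0 r) : Prop :=
  [/\ forall s t c, is_algaut s -> is_algaut t -> twcenter t c ->
        linear (act s (t \o s) c),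
      forall s t x c d h, is_algaut s -> is_algaut t ->
        twcenter t c -> twcenter t d ->
        act s (t \o s) (x *: c + d) h =
        x *: act s (t \o s) c h + act s (t \o s) d h,
      forall s h, is_algaut s -> act s s 1 h = h
    & forall s t t' c c' h, is_algaut s -> is_algaut t -> is_algaut t' ->
        twcenter t c -> twcenter t' c' ->
        act s (t' \o (t \o s)) (c' * c) h =
        act (t \o s) (t' \o (t \o s)) c' (act s (t \o s) c h)].

Lemma cap_twcenter_action : twcenter_action cap.
Proof.
split=> [s t c _ _ ct x h h'|s t x c d h _ _ ct dt|s h _|
         s t t' c c' h _ _ _ ct ct'].
- rewrite -[h]cls_surj -[h']cls_surj -linearP !(cap_cls _ ct) //.
  by rewrite mulrDr -scalerAr linearP.
- by rewrite /cap mulrDl -scalerAl linearP.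
- by rewrite /cap mul1r cls_surj.
rewrite -[h]cls_surj (cap_cls _ ct) // (cap_cls _ ct') // mulrA.
rewrite (@cap_cls s (t' \o t)) // => b /=.
by rewrite -mulrA ct mulrA ct' mulrA.
Qed.

End TwistedHomology.

Section IdealQuotient.
Variables (k : fieldType) (F : algType k) (R : F -> Prop).

(* The two-sided ideal generated by R is lspan ideal_gen.                     *)
Definition ideal_gen (v : F) : Prop := exists u r w, R r /\ v = u * r * w.

Definition idquot := lquot ideal_gen.

HB.instance Definition _ := GRing.Lmodule.on idquot.

Definition idcls : F -> idquot := lcls ideal_gen.

HB.instance Definition _ := GRing.Linear.on idcls.

Lemma idcls_surj (x : idquot) : idcls (repr x) = x.
Proof. exact: lcls_surj. Qed.

Lemma idcls_eq0 v : idcls v = 0 <-> v \in lspan ideal_gen.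
Proof.
rewrite -[v in v \in _]subr0 -(raddf0 idcls).
exact: lcls_eq.
Qed.

Lemma ideal_mull u v : v \in lspan ideal_gen -> u * v \in lspan ideal_gen.
Proof.
move: v; apply: lspan_ind => [|a v w [u' [r [w' [rr ->]]]] IH].
  by rewrite mulr0 rpred0.
rewrite mulrDr -scalerAr rpredD ?rpredZ //; apply: mem_lspan.
by exists (u * u'), r, w'; rewrite !mulrA.
Qed.

Lemma ideal_mulr u v : v \in lspan ideal_gen -> v * u \in lspan ideal_gen.
Proof.
move: v; apply: lspan_ind => [|a v w [u' [r [w' [rr ->]]]] IH].
  by rewrite mul0r rpred0.
rewrite mulrDl -scalerAl rpredD ?rpredZ //; apply: mem_lspan.
by exists u', r, (w' * u); rewrite !mulrA.
Qed.

Definition idquot_mul : idquot -> idquot -> idquot :=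
  locked (fun x y => idcls (repr x * repr y)).

Lemma idclsM u v : idcls (u * v) = idquot_mul (idcls u) (idcls v).
Proof.
rewrite /idquot_mul -lock; apply/esym/lcls_eq.
have -> : repr (idcls u) * repr (idcls v) - u * v =
  (repr (idcls u) - u) * repr (idcls v) + u * (repr (idcls v) - v).
  by rewrite mulrBl mulrBr addrA subrK.
by apply: rpredD; [apply: ideal_mulr|apply: ideal_mull]; apply: lcls_reprB.
Qed.

Fact idquot_mulA : associative idquot_mul.
Proof.
move=> x y z; rewrite -[x]idcls_surj -[y]idcls_surj -[z]idcls_surj.
by rewrite -!idclsM mulrA.
Qed.

Fact idquot_mul1l : left_id (idcls 1) idquot_mul.
Proof. by move=> x; rewrite -[x]idcls_surj -!idclsM mul1r. Qed.

Fact idquot_mul1r : right_id (idcls 1) idquot_mul.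
Proof. by move=> x; rewrite -[x]idcls_surj -!idclsM mulr1. Qed.

Fact idquot_mulDl : left_distributive idquot_mul +%R.
Proof.
move=> x y z; rewrite -[x]idcls_surj -[y]idcls_surj -[z]idcls_surj.
by rewrite -raddfD -!idclsM mulrDl raddfD.
Qed.

Fact idquot_mulDr : right_distributive idquot_mul +%R.
Proof.
move=> x y z; rewrite -[x]idcls_surj -[y]idcls_surj -[z]idcls_surj.
by rewrite -raddfD -!idclsM mulrDr raddfD.
Qed.

HB.instance Definition _ := GRing.Zmodule_isPzRing.Build idquot
  idquot_mulA idquot_mul1l idquot_mul1r idquot_mulDl idquot_mulDr.

Fact idcls_monoid_morphism : monoid_morphism idcls.
Proof. by split=> // u v; rewrite idclsM. Qed.

HB.instance Definition _ :=
  GRing.isMonoidMorphism.Build F idquot idcls idcls_monoid_morphism.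

Fact idquot_scaleAl a (x y : idquot) : a *: (x * y) = (a *: x) * y.
Proof.
by rewrite -[x]idcls_surj -[y]idcls_surj -linearZ -!rmorphM -linearZ scalerAl.
Qed.

Fact idquot_scaleAr a (x y : idquot) : a *: (x * y) = x * (a *: y).
Proof.
by rewrite -[x]idcls_surj -[y]idcls_surj -linearZ -!rmorphM -linearZ scalerAr.
Qed.

Lemma ideal_ker (B : algType k) (f : {lrmorphism F -> B}) :
  (forall r, R r -> f r = 0) -> forall v, v \in lspan ideal_gen -> f v = 0.
Proof.
move=> f0; apply: lspan_ind => [|a v w [u [r [w' [rr ->]]]] IH].
  exact: raddf0.
by rewrite linearP /= IH addr0 !rmorphM /= (f0 _ rr) mulr0 mul0r scaler0.
Qed.

End IdealQuotient.

Section PodlesRelations.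
Variables (k : fieldType) (q : k).

(* x_n, for n = -1, 0, 1, is the generator of index n + 1 in 'I_3. *)
Definition im1 : 'I_3 := @Ordinal 3 0 isT.
Definition i0 : 'I_3 := @Ordinal 3 1 isT.
Definition ip1 : 'I_3 := @Ordinal 3 2 isT.

Definition podles_rel (B : lalgType k) (y : 'I_3 -> B) : Prop :=
  [/\ y ip1 * y i0 = q ^- 2 *: (y i0 * y ip1),
      y im1 * y i0 = q ^+ 2 *: (y i0 * y im1),
      y ip1 * y im1 = q ^- 2 *: y i0 ^+ 2 + q^-1 *: y i0
    & y im1 * y ip1 = q ^+ 2 *: y i0 ^+ 2 + q *: y i0].

Definition generates (A : algType k) (x : 'I_3 -> A) : Prop :=
  forall Q : A -> Prop, Q 1 -> (forall i, Q (x i)) ->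
  (forall (c : k) a b, Q a -> Q b -> Q (c *: a + b)) ->
  (forall a b, Q a -> Q b -> Q (a * b)) -> forall a, Q a.

(* A is the universal algebra generated by the x i with the Podles relations. *)
Definition podles_universal (A : algType k) (x : 'I_3 -> A) : Prop :=
  [/\ podles_rel x, generates x
    & forall (B : algType k) (y : 'I_3 -> B), podles_rel y ->
        exists f : {lrmorphism A -> B}, forall i, f (x i) = y i].

End PodlesRelations.

(* Existence: a quotient of the free algebra {malg k[{fmonom 'I_3}]}.         *)
Section PodlesExists.
Variables (k : fieldType) (q : k).
Local Notation podles_rel := (podles_rel q).

Definition freealg := {malg k[{fmonom 'I_3}]}.

HB.instance Definition _ := GRing.Lalgebra.on freealg.

Fact freealg_scaleAr a (u v : freealg) : a *: (u * v) = u * (a *: v).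
Proof.
have uC : u * a%:MP = a *: u.
  rewrite malgM_def fgmulgU malgZ_def; apply: eq_bigr => m _.
  by rewrite mulrC mulm1.
by rewrite scalerAl -uC -mulrA mul_malgC.
Qed.

HB.instance Definition _ :=
  GRing.Lalgebra_isAlgebra.Build k freealg freealg_scaleAr.

Definition fgen (i : 'I_3) : freealg := << fmu i >>.

Section Eval.
Variables (B : algType k) (y : 'I_3 -> B).

Definition mon_eval (m : {fmonom 'I_3}) : B := \prod_(i <- m) y i.

Fact mon_eval_mmorphism : mmorphism mon_eval.
Proof.
split=> [m n|]; rewrite /mon_eval; last by rewrite fm1 big_nil.
by rewrite fmM big_cat.
Qed.

HB.instance Definition _ :=
  monalg.isMultiplicative.Build {fmonom 'I_3} B mon_eval mon_eval_mmorphism.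

Definition eval (g : freealg) : B := mmap (in_alg B) mon_eval g.

Fact eval_linear : linear eval.
Proof. by move=> a u v; rewrite /eval mmapD mmapZ mulr_algl. Qed.

Fact eval_monoid_morphism : monoid_morphism eval.
Proof.
have H := commr_mmap_is_multiplicative (f := in_alg B) (h := mon_eval).
have [|HM H1] := H _; last by split.
by move=> g m m'; rewrite /GRing.comm /= mulr_algl mulr_algr.
Qed.

HB.instance Definition _ :=
  GRing.isLinear.Build k freealg B *:%R eval eval_linear.
HB.instance Definition _ :=
  GRing.isMonoidMorphism.Build freealg B eval eval_monoid_morphism.

Lemma eval_gen i : eval (fgen i) = y i.
Proof. by rewrite /eval mmapU /= scale1r mul1r /mon_eval fmU big_seq1. Qed.

End Eval.

Definition podles_relators (B : lalgType k) (y : 'I_3 -> B) : seq B :=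
  [:: y ip1 * y i0 - q ^- 2 *: (y i0 * y ip1);
      y im1 * y i0 - q ^+ 2 *: (y i0 * y im1);
      y ip1 * y im1 - (q ^- 2 *: y i0 ^+ 2 + q^-1 *: y i0);
      y im1 * y ip1 - (q ^+ 2 *: y i0 ^+ 2 + q *: y i0)].

Lemma podles_relP (B : lalgType k) (y : 'I_3 -> B) :
  podles_rel y <-> (forall r, r \in podles_relators y -> r = 0).
Proof.
split=> [[e1 e2 e3 e4] r|H].
  rewrite !inE => /or4P[] /eqP->; apply/eqP; rewrite subr_eq0; exact/eqP.
by split; apply/eqP; rewrite -subr_eq0; apply/eqP/H; rewrite !inE eqxx ?orbT.
Qed.

Lemma map_podles_relators (F B : algType k) (f : {lrmorphism F -> B}) y :
  map f (podles_relators y) = podles_relators (f \o y).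
Proof.
by rewrite /podles_relators /= !(linearB, linearD, linearZ, rmorphM, rmorphXn).
Qed.

Lemma eval_relators (B : algType k) (y : 'I_3 -> B) :
  map (eval y) (podles_relators fgen) = podles_relators y.
Proof.
rewrite map_podles_relators; congr podles_relators.
by apply: funext => i; exact: eval_gen.
Qed.

Definition prepodles := idquot (fun r => r \in podles_relators fgen).

HB.instance Definition _ := GRing.PzRing.on prepodles.
HB.instance Definition _ := GRing.Lmodule.on prepodles.

Lemma podles_ideal_eval (B : algType k) (y : 'I_3 -> B) : podles_rel y ->
  forall v, v \in lspan (ideal_gen (fun r => r \in podles_relators fgen)) ->
  eval y v = 0.
Proof.
move=> /podles_relP y0; apply: ideal_ker => r rr; apply: y0.
by rewrite -eval_relators map_f.
Qed.

Fact podles_nonzero : 1 != 0 :> prepodles.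
Proof.
apply/eqP; rewrite -(rmorph1 (@idcls _ _ _)) => /idcls_eq0 H.
have z : podles_rel (fun=> 0 : k^o).
  by split; rewrite ?mulr0 ?expr0n ?scaler0 ?addr0.
by move/eqP: (podles_ideal_eval z H); rewrite rmorph1 oner_eq0.
Qed.

HB.instance Definition _ := GRing.PzSemiRing_isNonZero.Build prepodles
  podles_nonzero.
HB.instance Definition _ := GRing.Lmodule_isLalgebra.Build k prepodles
  (@idquot_scaleAl _ _ _).
HB.instance Definition _ := GRing.Lalgebra_isAlgebra.Build k prepodles
  (@idquot_scaleAr _ _ _).

Definition podles_cls : freealg -> prepodles := @idcls _ _ _.

HB.instance Definition _ := GRing.isLinear.Build k freealg prepodles *:%R
  podles_cls (fun c u v => linearP (@idcls _ _ _) c u v).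
HB.instance Definition _ := GRing.isMonoidMorphism.Build freealg prepodles
  podles_cls (@idcls_monoid_morphism _ _ _).

Lemma podles_cls_surj (a : prepodles) : podles_cls (repr a) = a.
Proof. exact: idcls_surj. Qed.

Lemma podles_clsM u v :
  podles_cls (u * v) = podles_cls u * podles_cls v :> prepodles.
Proof. exact: rmorphM. Qed.

Lemma podles_clsZ c u :
  podles_cls (c *: u) = c *: podles_cls u :> prepodles.
Proof. exact: linearZ. Qed.

Definition prex (i : 'I_3) : prepodles := podles_cls (fgen i).

Definition prelift (B : algType k) (y : 'I_3 -> B) (a : prepodles) : B :=
  eval y (repr a).

Section Lift.
Variables (B : algType k) (y : 'I_3 -> B) (yP : podles_rel y).

Lemma prelift_cls u : prelift y (podles_cls u) = eval y u.
Proof.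
apply/eqP; rewrite -subr_eq0 -linearB; apply/eqP.
exact/podles_ideal_eval/lcls_reprB.
Qed.

Lemma prelift_ex :
  exists f : {lrmorphism prepodles -> B}, forall i, f (prex i) = y i.
Proof.
have liftL : linear (prelift y).
  move=> a u v.
  rewrite -[u]podles_cls_surj -[v]podles_cls_surj -linearP !prelift_cls.
  exact: linearP.
have liftM : monoid_morphism (prelift y).
  split=> [|u v]; first by rewrite prelift_cls rmorph1.
  rewrite -[u]podles_cls_surj -[v]podles_cls_surj -rmorphM !prelift_cls.
  exact: rmorphM.
pose fL := GRing.isLinear.Build k prepodles B *:%R (prelift y) liftL.
pose fM := GRing.isMonoidMorphism.Build prepodles B (prelift y) liftM.
pose f : {lrmorphism prepodles -> B} := HB.pack (prelift y) fL fM.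
by exists f => i; rewrite /= prelift_cls eval_gen.
Qed.

End Lift.

Lemma prepodles_rel : podles_rel prex.
Proof.
apply/podles_relP => r.
have -> : podles_relators prex = map podles_cls (podles_relators fgen).
  by rewrite map_podles_relators.
case/mapP => u ur ->; apply/idcls_eq0/mem_lspan.
by exists 1, u, 1; rewrite mul1r mulr1.
Qed.

Lemma prepodles_gen : generates prex.
Proof.
move=> Q Q1 Qx QD QM a; rewrite -[a]podles_cls_surj; move: (repr a) => {a} u.
have Q0 : Q 0 by rewrite -(addNr 1) -scaleN1r; apply: QD.
rewrite [u]monalgE raddf_sum /=.
elim: (X in \sum_(i <- X) _) => [|m s IH]; first by rewrite big_nil.
rewrite big_cons; move: (u@_m) => c.
have -> : << c *g m >> = c *: << m >> :> freealg.
  by rewrite -mul_malgC malgM_def fgmulUU mulr1 mul1m.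
rewrite podles_clsZ; apply: QD IH.
case: m => m; elim: m => [|i m IH].
  have -> : FMonom [::] = mone :> {fmonom 'I_3} by rewrite [RHS]fmoneE.
  by rewrite -[<< _ >>]/(1 : freealg) rmorph1.
have -> : << FMonom (i :: m) >> = fgen i * << FMonom m >> :> freealg.
  rewrite malgM_def fgmulUU mulr1; congr (<< _ >>).
  by rewrite [RHS]fmmulE fmuE.
rewrite podles_clsM; exact: (QM _ _ (Qx i) IH).
Qed.

(* Opaque, so that podles_universal is all that is known about the algebra.  *)
Lemma podles_exists :
  {A : algType k & {x : 'I_3 -> A | podles_universal q x}}.
Proof.
exists prepodles, prex; split; [exact: prepodles_rel|exact: prepodles_gen|].
by move=> B y; apply: prelift_ex.
Qed.

End PodlesExists.


Section Podles.
Variables (k : fieldType) (q : k).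
Implicit Types (l m : k) (i : 'I_3).

Definition podles : algType k := projT1 (podles_exists q).

Definition x_ : 'I_3 -> podles := projT1 (projT2 (podles_exists q)).

Lemma podlesP : podles_universal q x_.
Proof. exact: projT2 (projT2 (podles_exists q)). Qed.

Lemma podles_x : podles_rel q x_.
Proof. by case: podlesP. Qed.

Lemma podles_ind : generates x_.
Proof. by case: podlesP. Qed.

Definition podles_lift (B : algType k) (y : 'I_3 -> B) (yP : podles_rel q y) :
  {lrmorphism podles -> B} :=
  projT1 (cid (let: And3 _ _ H := podlesP in H B y yP)).

Lemma podles_lift_x (B : algType k) (y : 'I_3 -> B) (yP : podles_rel q y) i :
  podles_lift yP (x_ i) = y i.
Proof. by rewrite /podles_lift; case: cid. Qed.

Fact sigma_rel l : l != 0 -> podles_rel q (fun i => l ^ (i%:Z - 1) *: x_ i).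
Proof.
move=> l0; have [e1 e2 e3 e4] := podles_x.
have [lm l00 lp] : [/\ l ^ (im1%:Z - 1) = l^-1, l ^ (i0%:Z - 1) = 1
  & l ^ (ip1%:Z - 1) = l] by [].
split; rewrite ?lm ?l00 ?lp ?scale1r -?scalerAr -?scalerAl ?scale1r.
- by rewrite e1 !scalerA (mulrC l).
- by rewrite e2 !scalerA (mulrC l^-1).
- by rewrite scalerA mulVf // scale1r.
- by rewrite scalerA mulfV // scale1r.
Qed.

(* The automorphism sigma_l, for l != 0 (junk value id for l = 0).            *)
Definition sigma (l : k) : podles -> podles :=
  if pselect (l != 0) is left l0 then podles_lift (sigma_rel l0) else id.

Lemma sigmaE l (l0 : l != 0) : sigma l = podles_lift (sigma_rel l0).
Proof.
rewrite /sigma; case: pselect => // l0'.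
by rewrite (bool_irrelevance l0' l0).
Qed.

Lemma sigma_x l i : l != 0 -> sigma l (x_ i) = l ^ (i%:Z - 1) *: x_ i.
Proof. by move=> l0; rewrite (sigmaE l0) podles_lift_x. Qed.

Lemma sigma_linear l : l != 0 -> linear (sigma l).
Proof. by move=> l0; rewrite (sigmaE l0); exact: linearP. Qed.

Lemma sigma_monoid_morphism l : l != 0 -> monoid_morphism (sigma l).
Proof.
by move=> l0; rewrite (sigmaE l0); split; [exact: rmorph1|exact: rmorphM].
Qed.

Lemma sigma1 : sigma 1 = id.
Proof.
have n1 := oner_neq0 k; apply: funext.
have [L1 LM] := sigma_monoid_morphism n1.
apply: podles_ind => [|i|c a b ea eb|a b ea eb].
- by [].
- by rewrite sigma_x // exp1rz scale1r.
- by rewrite sigma_linear // ea eb.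
- by rewrite LM ea eb.
Qed.

Lemma sigma_comp l m : l != 0 -> m != 0 -> sigma l \o sigma m = sigma (l * m).
Proof.
move=> l0 m0; have lm0 := mulf_neq0 l0 m0; apply: funext.
have [L1 LM] := sigma_monoid_morphism l0.
have [M1 MM] := sigma_monoid_morphism m0.
have [N1 NM] := sigma_monoid_morphism lm0.
apply: podles_ind => /= [|i|c a b ea eb|a b ea eb].
- by rewrite M1 L1 N1.
- rewrite !sigma_x // -[_ *: x_ i in LHS]addr0 sigma_linear //.
  rewrite sigma_x // scalerA expfzMl [_ * l ^ _]mulrC.
  suff -> : sigma l 0 = 0 by rewrite addr0.
  by rewrite -[X in sigma l X](addNr 1) -scaleN1r sigma_linear // scaleN1r addNr.
- by rewrite !sigma_linear // ea eb.
- by rewrite MM LM NM ea eb.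
Qed.

Lemma sigma_algaut l : l != 0 -> is_algaut (sigma l).
Proof.
move=> l0; split; [exact: sigma_linear|exact: sigma_monoid_morphism|].
have V0 : l^-1 != 0 by rewrite invr_eq0.
exists (sigma l^-1) => a.
  by rewrite -[LHS]/((sigma l^-1 \o sigma l) a) sigma_comp // mulVf // sigma1.
by rewrite -[LHS]/((sigma l \o sigma l^-1) a) sigma_comp // mulfV // sigma1.
Qed.

Lemma x0_twcenter : q != 0 -> twcenter (sigma (q ^+ 2)) (x_ i0).
Proof.
move=> q0; have q20 : q ^+ 2 != 0 by rewrite expf_neq0.
have [e1 e2 _ _] := podles_x.
have [L1 LM] := sigma_monoid_morphism q20.
apply: podles_ind => [|i|c a b ea eb|a b ea eb].
- by rewrite L1 mulr1 mul1r.
- rewrite sigma_x //; have [|] := boolP (i == i0).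
    by move/eqP->; rewrite scale1r.
  case: i => -[|[|[|//]]] // i3 _.
    rewrite (_ : Ordinal i3 = im1); last exact: val_inj.
    by rewrite -scalerAl e2 scalerA mulVf // scale1r.
  rewrite (_ : Ordinal i3 = ip1); last exact: val_inj.
  by rewrite -scalerAl e1 scalerA mulfV // scale1r.
- by rewrite sigma_linear // mulrDr mulrDl -scalerAl -scalerAr ea eb.
- by rewrite LM mulrA ea -mulrA eb mulrA.
Qed.

(* In the applications f is the action of x_0, with sigma_mod \o sigma l      *)
(* equal to sigma (q ^+ 2 * l) by sigma_comp.                                 *)
Definition x0_action_formulas l
    (f : H0 (sigma l) -> H0 (sigma (q ^+ 2 * l))) : Prop :=
  [/\ forall j, (0 < j)%N -> f (cls (sigma l) (x_ ip1 ^+ j)) = 0,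
      forall j, (0 < j)%N -> f (cls (sigma l) (x_ im1 ^+ j)) = 0
    & forall n, f (cls (sigma l) (x_ i0 ^+ n)) =
        cls (sigma (q ^+ 2 * l)) (x_ i0 ^+ n.+1)].

End Podles.

Arguments podles {k} q.
Arguments x_ {k} q i.
Arguments sigma {k} q l a.

(* Main.v *)
Require Import Defs.
From HB Require Import structures.
From mathcomp Require Import all_boot all_order all_algebra.
From mathcomp Require Import boolp functions reals complex zify ring.

(** The formulas for the cap product by x_0 are commutator computations. The
class of x_0^m x_{+-1}^i vanishes for m, i > 0, because moving one x_0
cyclically around this product multiplies it by q^(+-2 i), which is not 1
(cls_x0_mul_exp). The classes of the powers of x_0 satisfy a two-term
recursion, obtained by moving x_1 cyclically around x_0^j x_{-1} x_1
(cls_x0_rec); its coefficients give both evaluations of [x_0^(i + 1)].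

That these formulas determine the action needs two generation results. On the
side of homology, the monomials x_0^m x_{+-1}^i span A (pbw_span), so that H_0
is spanned by the classes of the powers of the generators (H0_linear_eq). On the
side of the twisted centre, if c is not 0 and c b = t(b) c for all b, then c is
a multiple of some x_0^d, and t is sigma_{q^(2 d)} (twcenterE).

The latter is proved inside a skew Laurent ring in z over k[h], where
z h = q^-2 h z. It receives a map from A that sends x_0 to h, x_1 to z and
x_{-1} to (q^2 h^2 + q h) z^-1. An element of this ring is written as a sum of
z^n v(n), and encoded by the sequence v of polynomials; A acts on all such
sequences by left multiplication (rho), and the sequence of a (symb) is the
value of its operator at the sequence of 1. This map is injective (symb_inj),
and the ring is graded without zero divisors. If b is a generator, comparing the
top and bottom degrees in c b = t(b) c shows that t(b) is homogeneous of the
same degree as b (symb_intertwined). Hence c b = t(b) c becomes, in every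
degree, one identity between polynomials in h, and these identities, for the
three generators, force c to be a multiple of some x_0^d. *)

Set Implicit Arguments.
Unset Strict Implicit.
Unset Printing Implicit Defensive.

Import Order.TTheory GRing.Theory Num.Theory.
Local Open Scope ring_scope.

Lemma linear_at0 (k : fieldType) (U W : lmodType k) (f : U -> W) :
  linear f -> f 0 = 0.
Proof.
move=> fL; have := fL 1 0 0.
by rewrite !scale1r addr0 -[X in X = _]addr0 => /addrI.
Qed.

(** * The endomorphism algebra of the sequences of polynomials *)

Section Endomorphisms.
Variables (k : fieldType).
Local Notation V := (int -> {poly k}).

(** The target of the representation below. Its elements are bundled with
their linearity because composing with an arbitrary map on the left does not
distribute over sums. *)
Record endo := Endo { endo_fun :> V -> V; endo_linear : linear endo_fun }.

Lemma endoP (f g : endo) : (forall v, f v = g v) -> f = g.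
Proof.
case: f g => f fL [g gL] /= fg; have {}fg : f = g by apply: funext.
by case: g / fg gL => gL; congr Endo; apply: Prop_irrelevance.
Qed.

HB.instance Definition _ := gen_eqMixin endo.
HB.instance Definition _ := gen_choiceMixin endo.

Fact endo0_linear : linear (fun _ : V => 0 : V).
Proof. by move=> a u v; rewrite scaler0 addr0. Qed.

Fact endo1_linear : linear (fun v : V => v).
Proof. by []. Qed.

Fact endoN_linear (f : endo) : linear (fun v => - f v).
Proof. by move=> a u v; rewrite endo_linear opprD scalerN. Qed.

Fact endoD_linear (f g : endo) : linear (fun v => f v + g v).
Proof. by move=> a u v; rewrite !endo_linear scalerDr addrACA. Qed.

Fact endoM_linear (f g : endo) : linear (fun v => f (g v)).
Proof. by move=> a u v; rewrite !endo_linear. Qed.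

Fact endoZ_linear (c : k) (f : endo) : linear (fun v => c *: f v).
Proof. by move=> a u v; rewrite endo_linear scalerDr !scalerA mulrC. Qed.

Let add f g := Endo (endoD_linear f g).
Let mul f g := Endo (endoM_linear f g).
Let scale c f := Endo (endoZ_linear c f).

Fact endo_addA : associative add.
Proof. by move=> f g h; apply: endoP => v /=; rewrite addrA. Qed.

Fact endo_addC : commutative add.
Proof. by move=> f g; apply: endoP => v /=; rewrite addrC. Qed.

Fact endo_add0 : left_id (Endo endo0_linear) add.
Proof. by move=> f; apply: endoP => v /=; rewrite add0r. Qed.

Fact endo_addN :
  left_inverse (Endo endo0_linear) (fun f => Endo (endoN_linear f)) add.
Proof. by move=> f; apply: endoP => v /=; rewrite addNr. Qed.

HB.instance Definition _ := GRing.isZmodule.Build endo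
  endo_addA endo_addC endo_add0 endo_addN.

Fact endo_mulA : associative mul.
Proof. by move=> f g h; apply: endoP. Qed.

Fact endo_mul1l : left_id (Endo endo1_linear) mul.
Proof. by move=> f; apply: endoP. Qed.

Fact endo_mul1r : right_id (Endo endo1_linear) mul.
Proof. by move=> f; apply: endoP. Qed.

Fact endo_mulDl : left_distributive mul +%R.
Proof. by move=> f g h; apply: endoP. Qed.

Lemma endo_addr (f : endo) : {morph f : u v / u + v}.
Proof. by move=> u v; rewrite -[u]scale1r endo_linear !scale1r. Qed.

Fact endo_mulDr : right_distributive mul +%R.
Proof. by move=> f g h; apply: endoP => v; apply: endo_addr. Qed.

Fact endo_nonzero : Endo endo1_linear != 0.
Proof.
apply/eqP => /(congr1 (fun f : endo => f (fun=> 1) 0)) /= /eqP.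
by rewrite oner_eq0.
Qed.

HB.instance Definition _ := GRing.Zmodule_isNzRing.Build endo
  endo_mulA endo_mul1l endo_mul1r endo_mulDl endo_mulDr endo_nonzero.

Fact endo_scaleA a b f : scale a (scale b f) = scale (a * b) f.
Proof. by apply: endoP => v /=; rewrite scalerA. Qed.

Fact endo_scale1 : left_id 1 scale.
Proof. by move=> f; apply: endoP => v /=; rewrite scale1r. Qed.

Fact endo_scaleDr : right_distributive scale +%R.
Proof. by move=> a f g; apply: endoP => v /=; rewrite scalerDr. Qed.

Fact endo_scaleDl f : {morph scale^~ f : a b / a + b}.
Proof. by move=> a b; apply: endoP => v /=; rewrite scalerDl. Qed.

HB.instance Definition _ := GRing.Zmodule_isLmodule.Build k endo
  endo_scaleA endo_scale1 endo_scaleDr endo_scaleDl.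

Fact endo_scaleAl a (f g : endo) : a *: (f * g) = (a *: f) * g.
Proof. by apply: endoP. Qed.

Fact endo_scaleAr a (f g : endo) : a *: (f * g) = f * (a *: g).
Proof.
apply: endoP => v /=; have := endo_linear f a (g v) 0.
by rewrite (linear_at0 (endo_linear f)) !addr0 => <-.
Qed.

HB.instance Definition _ := GRing.Lmodule_isLalgebra.Build k endo endo_scaleAl.
HB.instance Definition _ := GRing.Lalgebra_isAlgebra.Build k endo endo_scaleAr.

End Endomorphisms.

(** * Dilations of the variable *)

Section Dilation.
Variables (k : fieldType).
Implicit Types (c d : k) (g : {poly k}).

Local Notation dil c := (comp_poly (c *: 'X)).

Lemma dilX c : dil c 'X = c *: 'X :> {poly k}.
Proof. exact: comp_polyX. Qed.

Lemma dilM c d g : dil c (dil d g) = dil (d * c) g.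
Proof. by rewrite -comp_polyA comp_polyZ comp_polyX scalerA. Qed.

Lemma dil1 g : dil 1 g = g.
Proof. by rewrite scale1r comp_polyXr. Qed.

Lemma dil_eq0 c g : c != 0 -> (dil c g == 0) = (g == 0).
Proof.
move=> c0; apply/eqP/eqP => [e|->]; last exact: raddf0.
by rewrite -[g]dil1 -(mulfV c0) -dilM e raddf0.
Qed.

Lemma horner_dil c g y : (dil c g).[y] = g.[c * y].
Proof. by rewrite horner_comp !hornerE. Qed.

Lemma coef_dil c g i : (dil c g)`_i = c ^+ i * g`_i.
Proof.
rewrite comp_polyE coef_sum.
under eq_bigr do rewrite coefZ exprZn coefZ coefXn.
have [lt_ig|le_gi] := ltnP i (size g).
  rewrite (bigD1 (Ordinal lt_ig)) //= eqxx mulr1 mulrC big1 ?addr0 // => j.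
  by rewrite -val_eqE /= eq_sym => /negPf->; rewrite !mulr0.
rewrite nth_default // mulr0 big1 // => j _.
by rewrite gtn_eqF ?mulr0 // (leq_trans (ltn_ord j)).
Qed.

Lemma size_dil c g : c != 0 -> size (dil c g) = size g.
Proof.
by move=> c0; rewrite size_comp_poly2 // size_scale // size_polyX.
Qed.

End Dilation.

(** * The representation by operators on sequences *)

Section Representation.
Variables (k : fieldType) (q : k).
Hypothesis q0 : q != 0.
Local Notation w := (q ^+ 2).
Local Notation dil c := (comp_poly (c *: 'X)).
Local Notation V := (int -> {poly k}).
Implicit Types (v : V) (g : {poly k}) (n m : int).

Lemma w0 : w != 0. Proof. exact: expf_neq0. Qed.

Lemma wX0 n : w ^ n != 0. Proof. exact: expfz_neq0 w0. Qed.

Lemma wD n m : w ^ (n + m) = w ^ n * w ^ m. Proof. exact: expfzDr w0. Qed.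

Lemma wS n : w ^ (n + 1) = w * w ^ n. Proof. by rewrite wD mulrC. Qed.

(** The polynomial z^-n (q^2 h^2 + q h) z^n, which x_{-1} contributes when it
takes degree n + 1 down to degree n; at n = 0 it is x_{-1} x_1. *)
Definition xm_coef n : {poly k} := dil (w ^ n) (w *: 'X ^+ 2 + q *: 'X).

Fact opx0_linear : linear (fun v n => (w ^ n *: 'X) * v n).
Proof.
move=> a u v; apply: funext => n.
by rewrite [LHS]mulrDr -scalerAr.
Qed.

Fact opxp_linear : linear (fun v n => v (n - 1)).
Proof. by []. Qed.

Fact opxm_linear : linear (fun v n => xm_coef n * v (n + 1)).
Proof.
by move=> a u v; apply: funext => n; rewrite [LHS]mulrDr -scalerAr.
Qed.

(** The operators of left multiplication by h, z and (q^2 h^2 + q h) z^-1 on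
the formal sums of z^n v(n), where z h = q^-2 h z. *)
Definition gen_op (i : 'I_3) : endo k :=
  if i == i0 then Endo opx0_linear
  else if i == ip1 then Endo opxp_linear else Endo opxm_linear.

Lemma xm_coefE n : xm_coef n = w *: (w ^ n *: 'X) ^+ 2 + q *: (w ^ n *: 'X).
Proof. by rewrite /xm_coef comp_polyD !comp_polyZ rmorphXn /= comp_polyX. Qed.

Lemma dil_xm_coef n m : dil (w ^ m) (xm_coef n) = xm_coef (n + m).
Proof. by rewrite /xm_coef dilM wD. Qed.

Fact gen_op_rel : podles_rel q gen_op.
Proof.
split; apply: endoP => v; apply: funext => n /=.
- rewrite -[LHS]/(w ^ (n - 1) *: 'X * v (n - 1)).
  rewrite -[RHS]/(w^-1 *: (w ^ n *: 'X * v (n - 1))).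
  by rewrite scalerAl scalerA wD [_ * w ^ _]mulrC.
- rewrite -[LHS]/(xm_coef n * (w ^ (n + 1) *: 'X * v (n + 1))).
  rewrite -[RHS]/(w *: (w ^ n *: 'X * (xm_coef n * v (n + 1)))).
  by rewrite wS -scalerA -!scalerAl -!scalerAr mulrCA.
- rewrite -[LHS]/(xm_coef (n - 1) * v (n - 1 + 1)) subrK.
  rewrite -[RHS]/(w^-1 *: (w ^ n *: 'X * (w ^ n *: 'X * v n)) +
                  q^-1 *: (w ^ n *: 'X * v n)).
  rewrite !scalerAl mulrA -mulrDl xm_coefE wD exprN1; congr (_ * _).
  rewrite -scalerAl -expr2 !exprZn !scalerA.
  by congr (_ *: _ + _ *: _); field; rewrite q0.
rewrite -[LHS]/(xm_coef n * v (n + 1 - 1)) addrK.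
rewrite -[RHS]/(w *: (w ^ n *: 'X * (w ^ n *: 'X * v n)) +
                  q *: (w ^ n *: 'X * v n)).
rewrite !scalerAl mulrA -mulrDl xm_coefE; congr (_ * _).
by rewrite -scalerAl -expr2.
Qed.

Definition rho : {lrmorphism podles q -> endo k} := podles_lift gen_op_rel.

Lemma rho_x0 v n : rho (x_ q i0) v n = w ^ n *: 'X * v n.
Proof. by rewrite /rho podles_lift_x. Qed.

Lemma rho_xp v n : rho (x_ q ip1) v n = v (n - 1).
Proof. by rewrite /rho podles_lift_x. Qed.

Lemma rho_xm v n : rho (x_ q im1) v n = xm_coef n * v (n + 1).
Proof. by rewrite /rho podles_lift_x. Qed.

Lemma rhoM a b v : rho (a * b) v = rho a (rho b v).
Proof. by rewrite rmorphM. Qed.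

Lemma rho_ind (Q : endo k -> Prop) : Q 1 ->
  Q (rho (x_ q i0)) -> Q (rho (x_ q ip1)) -> Q (rho (x_ q im1)) ->
  (forall c (f h : endo k), Q f -> Q h -> Q (c *: f + h)) ->
  (forall f h, Q f -> Q h -> Q (f * h)) -> forall a, Q (rho a).
Proof.
move=> Q1 Qz Qp Qm QD QM.
apply: podles_ind => [|i|c a b|a b]; rewrite ?rmorph1 ?linearP ?rmorphM //=.
- case: i => -[|[|[|//]]] i3.
  + by rewrite (_ : Ordinal i3 = im1) //; apply: val_inj.
  + by rewrite (_ : Ordinal i3 = i0) //; apply: val_inj.
  + by rewrite (_ : Ordinal i3 = ip1) //; apply: val_inj.
- exact: QD.
- exact: QM.
Qed.

(** The sequence of the element z^m g. *)
Definition mono m g : V := fun n => if n == m then g else 0.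
Local Notation e0 := (mono 0 1).

(** Multiplication on the right by z^m g in the skew Laurent ring: moving z^m
to the left of v (n - m) dilates that polynomial. *)
Definition rmul m g v : V := fun n => dil (w ^ m) (v (n - m)) * g.

Lemma rmul_mono m g : rmul m g e0 = mono m g.
Proof.
apply: funext => n; rewrite /rmul /mono subr_eq0.
by case: eqP => _; rewrite ?rmorph1 ?mul1r // raddf0 mul0r.
Qed.

(** A left multiplication commutes with every right multiplication. Hence the
operator rho a is known once its value at the sequence of 1 is. *)
Lemma rho_rmul a m g v : rho a (rmul m g v) = rmul m g (rho a v).
Proof.
move: v; pose Q f := forall v, f (rmul m g v) = rmul m g (f v).
apply: (rho_ind (Q := Q)); rewrite /Q.
- by [].
- move=> v; apply: funext => n; rewrite rho_x0 /rmul rho_x0.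
  by rewrite rmorphM /= comp_polyZ comp_polyX scalerA -wD subrK mulrA.
- by move=> v; apply: funext => n; rewrite rho_xp /rmul rho_xp addrAC.
- move=> v; apply: funext => n; rewrite rho_xm /rmul rho_xm.
  by rewrite rmorphM /= dil_xm_coef subrK mulrA addrAC.
- move=> c f h fP hP v; apply: funext => n.
  rewrite -[LHS]/(c *: f (rmul m g v) n + h (rmul m g v) n) fP hP.
  rewrite -[RHS]/(dil (w ^ m) (c *: f v (n - m) + h v (n - m)) * g).
  by rewrite linearP /= mulrDl scalerAl.
- by move=> f h fP hP v; rewrite -[LHS]/(f (h (rmul m g v))) hP fP.
Qed.

(** The coefficients of a in the skew Laurent ring: the sequence of the element
that a becomes there. *)
Definition symb a : V := rho a e0.

Lemma rho_mono a m g : rho a (mono m g) = rmul m g (symb a).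
Proof. by rewrite -rmul_mono rho_rmul. Qed.

Definition finsupp (v : V) := exists B : nat, forall n, (B < `|n|)%N -> v n = 0.

Lemma rho_finsupp a v : finsupp v -> finsupp (rho a v).
Proof.
move: v; apply: (rho_ind (Q := fun f => forall v, finsupp v -> finsupp (f v))).
- by [].
- by move=> v [B vB]; exists B => n ?; rewrite rho_x0 vB ?mulr0.
- by move=> v [B vB]; exists B.+1 => n ?; rewrite rho_xp vB //; lia.
- by move=> v [B vB]; exists B.+1 => n ?; rewrite rho_xm vB ?mulr0 //; lia.
- move=> c f h fP hP v vP; have [B fB] := fP v vP; have [C hC] := hP v vP.
  exists (maxn B C) => n ?.
  rewrite -[LHS]/(c *: f v n + h v n) fB ?hC ?scaler0 ?addr0 //; lia.
- by move=> f h fP hP v /hP/fP.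
Qed.

Lemma symb_finsupp a : finsupp (symb a).
Proof.
apply: rho_finsupp; exists 0%N => n n0; rewrite /mono; case: eqP => // e.
by rewrite e in n0.
Qed.

Lemma finsupp_split v m : finsupp v -> exists s : seq int,
  m \notin s /\ v = mono m (v m) + \sum_(j <- s) mono j (v j).
Proof.
move=> [B vB].
pose s := [seq j <- [seq i%:Z - B%:Z | i <- iota 0 (B + B).+1] | j != m].
exists s; split; first by rewrite mem_filter eqxx.
have us : uniq s.
  by rewrite filter_uniq // map_inj_uniq ?iota_uniq // => i j; lia.
apply: funext => n.
rewrite -[RHS]/(mono m (v m) n + (\sum_(j <- s) mono j (v j)) n).
have -> : (\sum_(j <- s) mono j (v j)) n = \sum_(j <- s) mono j (v j) n.
  by elim/big_ind2: _ => // x x' y y' <- <-.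
have [->|nm] := eqVneq n m.
  rewrite /mono eqxx big_seq big1 ?addr0 // => j.
  by rewrite mem_filter eq_sym => /andP[/negPf->].
rewrite {1}/mono (negPf nm) add0r.
have [ns|ns] := boolP (n \in s).
  rewrite (bigD1_seq n) //= {1}/mono eqxx big1 ?addr0 // => j jn.
  by rewrite /mono eq_sym (negPf jn).
rewrite big1_seq => [|j /= js]; last first.
  by rewrite /mono; case: eqP => // nj; rewrite nj js in ns.
apply: vB; apply: contraR ns; rewrite -leqNgt => nB.
rewrite mem_filter nm; apply/mapP; exists (absz (n + B%:Z)); last by lia.
by rewrite mem_iota; lia.
Qed.

(** A coefficient of a product is the sum of the products of coefficients whose
degrees add up to n; the case needed is that only one of them can survive. *)
Lemma rho_local a v n m : finsupp v ->
  (forall j, j != m -> v j != 0 -> symb a (n - j) = 0) ->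
  rho a v n = dil (w ^ m) (symb a (n - m)) * v m.
Proof.
move=> /(finsupp_split m)[s [ms vE]] loc.
rewrite [in LHS]vE endo_addr.
rewrite -[LHS]/(rho a (mono m (v m)) n + rho a (\sum_(j <- s) mono j (v j)) n).
rewrite rho_mono [X in _ + X](_ : _ = 0) ?addr0 //.
elim: s ms {vE} => [|j s IH].
  by rewrite big_nil (linear_at0 (endo_linear _)).
rewrite inE negb_or big_cons endo_addr => /andP[mj /IH e].
rewrite -[LHS]/(rho a (mono j (v j)) n + rho a (\sum_(j <- s) mono j (v j)) n).
rewrite e addr0 rho_mono /rmul; have [->|vj] := eqVneq (v j) 0.
  by rewrite mulr0.
by rewrite loc ?raddf0 ?mul0r // eq_sym.
Qed.

(** * Spanning monomials and faithfulness *)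

Local Notation X0 := (x_ q i0).
Local Notation Xp := (x_ q ip1).
Local Notation Xm := (x_ q im1).
Local Notation e := (horner_alg X0).

Lemma xp_x0 : Xp * X0 = w^-1 *: (X0 * Xp).
Proof. by case: (podles_x q). Qed.

Lemma xm_x0 : Xm * X0 = w *: (X0 * Xm).
Proof. by case: (podles_x q). Qed.

Lemma xp_xm : Xp * Xm = w^-1 *: X0 ^+ 2 + q^-1 *: X0.
Proof. by case: (podles_x q). Qed.

Lemma xm_xp : Xm * Xp = w *: X0 ^+ 2 + q *: X0.
Proof. by case: (podles_x q). Qed.

Lemma skew_comm_exp c x (y : podles q) (m : nat) :
  x * y = c *: (y * x) -> x * y ^+ m = c ^+ m *: (y ^+ m * x).
Proof.
move=> xy; elim: m => [|m IH]; first by rewrite !expr0 scale1r mulr1 mul1r.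
rewrite {1}exprSr mulrA IH -scalerAl -[_ * x * y]mulrA xy.
by rewrite -scalerAr scalerA -exprSr mulrA -exprSr.
Qed.

Definition pbw_mono (a : podles q) := exists m i : nat,
  a = X0 ^+ m * Xp ^+ i \/ a = X0 ^+ m * Xm ^+ i.

(** The span of these monomials contains 1 and is stable under left
multiplication by the generators: x_0 is moved to the left, and a product
x_1 x_{-1} or x_{-1} x_1 becomes a polynomial in x_0. *)
Lemma pbw_span a : a \in lspan pbw_mono.
Proof.
have gen i b : b \in lspan pbw_mono -> x_ q i * b \in lspan pbw_mono.
  move: b; apply: lspan_ind => [|c u b [m [j uE]] IH].
    by rewrite mulr0 rpred0.
  rewrite mulrDr -scalerAr rpredD // rpredZ //.
  have Sp (m' j' : nat) : X0 ^+ m' * Xp ^+ j' \in lspan pbw_mono.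
    by apply: mem_lspan; exists m', j'; left.
  have Sm (m' j' : nat) : X0 ^+ m' * Xm ^+ j' \in lspan pbw_mono.
    by apply: mem_lspan; exists m', j'; right.
  case: i IH => -[|[|[|//]]] i3 IH.
  - rewrite (_ : Ordinal i3 = im1); last exact: val_inj.
    case: uE => ->; rewrite mulrA (skew_comm_exp _ xm_x0) -scalerAl;
      rewrite rpredZ // -mulrA.
      case: j => [|j]; first by rewrite expr0 mulr1 -[X in _ * X]expr1.
      rewrite exprS [Xm * _]mulrA xm_xp mulrDl mulrDr -!scalerAl -!scalerAr.
      by rewrite !(mulrA (X0 ^+ m) _ (_ ^+ j)) -exprD -exprSr rpredD ?rpredZ.
    by rewrite -exprS.
  - rewrite (_ : Ordinal i3 = i0); last exact: val_inj.
    by case: uE => ->; rewrite mulrA -exprS.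
  - rewrite (_ : Ordinal i3 = ip1); last exact: val_inj.
    case: uE => ->; rewrite mulrA (skew_comm_exp _ xp_x0) -scalerAl;
      rewrite rpredZ // -mulrA.
      by rewrite -exprS.
    case: j => [|j]; first by rewrite expr0 mulr1 -[X in _ * X]expr1.
    rewrite exprS [Xp * _]mulrA xp_xm mulrDl mulrDr -!scalerAl -!scalerAr.
    by rewrite !(mulrA (X0 ^+ m) _ (_ ^+ j)) -exprD -exprSr rpredD ?rpredZ.
suff: forall b, b \in lspan pbw_mono -> a * b \in lspan pbw_mono.
  rewrite -{2}[a]mulr1; apply; apply: mem_lspan; exists 0%N, 0%N; left.
  by rewrite !expr0 mulr1.
move: a; apply: podles_ind => [b|i|c a b aS bS d dS|a b aS bS d dS].
- by rewrite mul1r.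
- exact: gen.
- by rewrite mulrDl -scalerAl rpredD ?rpredZ ?aS ?bS.
- by rewrite -mulrA aS // bS.
Qed.

Lemma symbM_mono a b m g :
  symb b = mono m g -> symb (a * b) = rmul m g (symb a).
Proof. by move=> bE; rewrite /symb rhoM -/(symb b) bE rho_mono. Qed.

Lemma symb_x0 : symb X0 = mono 0 'X.
Proof.
apply: funext => n; rewrite /symb rho_x0 /mono; case: eqP => [->|_].
  by rewrite mulr1 scale1r.
by rewrite mulr0.
Qed.

Lemma symb_xp : symb Xp = mono 1 1.
Proof. by apply: funext => n; rewrite /symb rho_xp /mono subr_eq0. Qed.

Lemma symb_xm : symb Xm = mono (-1) (xm_coef (-1)).
Proof.
apply: funext => n; rewrite /symb rho_xm /mono addr_eq0.
by case: eqP => [->|_]; rewrite ?mulr1 ?mulr0.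
Qed.

Lemma symbD a b n : symb (a + b) n = symb a n + symb b n.
Proof. by rewrite /symb raddfD. Qed.

Lemma symbZ c a n : symb (c *: a) n = c *: symb a n.
Proof. by rewrite /symb linearZ. Qed.

Lemma symb_alg g : symb (e g) = mono 0 g.
Proof.
elim/poly_ind: g => [|g c IH].
  rewrite raddf0; apply: funext => n; rewrite /mono if_same.
  by rewrite /symb raddf0.
rewrite rmorphD rmorphM /= horner_algX horner_algC; apply: funext => n.
rewrite symbD (symbM_mono _ symb_x0) IH /rmul expr0z /mono subr0.
rewrite symbZ /symb rmorph1 -[(1 : endo k) e0]/e0 /mono.
case: eqP => _; first by rewrite dil1 alg_polyC.
by rewrite raddf0 mul0r scaler0 addr0.
Qed.

Lemma xm_coef_neq0 n : xm_coef n != 0.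
Proof.
rewrite dil_eq0 ?wX0 //; apply/eqP => /(congr1 (fun p : {poly k} => p`_1)) /eqP.
by rewrite coefD !coefZ coefXn coefX coef0 /= mulr0 add0r mulr1 (negPf q0).
Qed.

(** The monomials are collected by degree: the coefficient of F of index i
gathers those with x_1^i, and that of G those with x_{-1}^(i + 1). This shift
puts the degree 0 into F alone, so that no two terms have the same degree. *)
Lemma pbw_expansion a : exists F G : {poly {poly k}},
  a = (map_poly e F).[Xp] + (map_poly e G).[Xm] * Xm.
Proof.
have := pbw_span a; move: a; apply: lspan_ind => [|c u b [m [j uE]] [F [G ->]]].
  by exists 0, 0; rewrite rmorph0 !horner0 mul0r addr0.
have E H x i : (map_poly e (((c *: 'X^m)%:P * 'X^i) + H)).[x] =
    c *: (X0 ^+ m * x ^+ i) + (map_poly e H).[x].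
  rewrite rmorphD rmorphM /= map_polyXn map_polyC /= hornerD mul_polyC hornerZ.
  by rewrite hornerXn linearZ /= rmorphXn /= horner_algX mulr_algl -scalerAl.
case: uE => ->.
  by exists ((c *: 'X^m)%:P * 'X^j + F), G; rewrite E addrA.
case: j => [|j].
  by exists ((c *: 'X^m)%:P * 'X^0 + F), G; rewrite E addrA.
exists F, ((c *: 'X^m)%:P * 'X^j + G).
by rewrite E mulrDl exprSr -scalerAl mulrA addrCA.
Qed.

Lemma symb_alg_xp_eq0 F :
  (forall n, n >= 0 -> symb (map_poly e F).[Xp] n = 0) -> F = 0.
Proof.
elim/poly_ind: F => // F c IH.
rewrite rmorphD rmorphM /= map_polyX map_polyC /= hornerD hornerMX hornerC => H.
have {}H n : n >= 0 ->
    dil w (symb (map_poly e F).[Xp] (n - 1)) + mono 0 c n = 0.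
  move=> /H; rewrite symbD (symbM_mono _ symb_xp) symb_alg.
  by rewrite /rmul expr1z mulr1.
have F0 : F = 0.
  apply: IH => n n_ge0; have := H (n + 1); rewrite addrK /mono.
  rewrite gt_eqF ?addr0; last by lia.
  rewrite (_ : 0 <= n + 1) => [/(_ isT)/eqP|]; last by lia.
  by rewrite dil_eq0 ?w0 // => /eqP.
have := H 0 (lexx _); rewrite F0 map_poly0 horner0 /symb raddf0 /mono eqxx.
by rewrite -[X in dil _ X]/(0 : {poly k}) raddf0 add0r mul0r add0r => ->.
Qed.

Lemma symb_alg_xm_eq0 F :
  (forall n, n <= 0 -> symb (map_poly e F).[Xm] n = 0) -> F = 0.
Proof.
elim/poly_ind: F => // F c IH.
rewrite rmorphD rmorphM /= map_polyX map_polyC /= hornerD hornerMX hornerC => H.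
have {}H n : n <= 0 ->
    dil w^-1 (symb (map_poly e F).[Xm] (n + 1)) * xm_coef (-1) + mono 0 c n = 0.
  move=> /H; rewrite symbD (symbM_mono _ symb_xm) symb_alg.
  by rewrite /rmul exprN1 opprK.
have F0 : F = 0.
  apply: IH => n n_le0; have := H (n - 1); rewrite subrK /mono.
  rewrite lt_eqF ?addr0; last by lia.
  rewrite (_ : n - 1 <= 0) => [/(_ isT)/eqP|]; last by lia.
  rewrite mulf_eq0 (negPf (xm_coef_neq0 _)) orbF dil_eq0 ?invr_eq0 ?w0 //.
  by move/eqP.
have := H 0 (lexx _); rewrite F0 map_poly0 horner0 /symb raddf0 /mono eqxx.
by rewrite -[X in dil _ X]/(0 : {poly k}) raddf0 mul0r add0r mul0r add0r => ->.
Qed.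

(** The two parts of the expansion have their coefficients in degrees n >= 0
and n < 0, so that each of them vanishes; and within each part, the coefficient
in one degree is a dilated coefficient of F or G, times a nonzero product of
values of xm_coef. *)
Lemma symb_inj a : (forall n, symb a n = 0) -> a = 0.
Proof.
have [F [G ->]] := pbw_expansion a => H.
have sG n : symb ((map_poly e G).[Xm] * Xm) n =
    dil w^-1 (symb (map_poly e G).[Xm] (n + 1)) * xm_coef (-1).
  by rewrite (symbM_mono _ symb_xm) /rmul exprN1 opprK.
have Fneg n : n < 0 -> symb (map_poly e F).[Xp] n = 0.
  elim/poly_ind: F {H} n => [|F c IH] n n0.
    by rewrite map_poly0 horner0 /symb raddf0.
  rewrite rmorphD rmorphM /= map_polyX map_polyC /= hornerD hornerMX hornerC.
  rewrite symbD (symbM_mono _ symb_xp) symb_alg /rmul IH; last by lia.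
  by rewrite raddf0 mul0r add0r /mono lt_eqF.
have Gpos n : n > 0 -> symb (map_poly e G).[Xm] n = 0.
  elim/poly_ind: G {H sG} n => [|G c IH] n n0.
    by rewrite map_poly0 horner0 /symb raddf0.
  rewrite rmorphD rmorphM /= map_polyX map_polyC /= hornerD hornerMX hornerC.
  rewrite symbD (symbM_mono _ symb_xm) symb_alg /rmul IH; last by lia.
  by rewrite raddf0 mul0r add0r /mono gt_eqF.
have F0 : F = 0.
  apply: symb_alg_xp_eq0 => n n0; have := H n.
  by rewrite symbD sG Gpos ?raddf0 ?mul0r ?addr0 //; lia.
have G0 : G = 0.
  apply: symb_alg_xm_eq0 => n n0; have := H (n - 1).
  rewrite symbD sG Fneg; last by lia.
  rewrite subrK add0r => /eqP.
  rewrite mulf_eq0 (negPf (xm_coef_neq0 _)) orbF dil_eq0 ?invr_eq0 ?w0 //.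
  by move/eqP.
by rewrite F0 G0 !map_poly0 !horner0 mul0r addr0.
Qed.

(** A coefficient in a negative degree is a multiple of xm_coef (-1), of which
- q is a root. This tells the image of A apart from the whole skew Laurent ring,
in which the powers of z are twisted central elements too. *)
Lemma symb_root a n : n < 0 -> (symb a n).[- q] = 0.
Proof.
pose P (v : V) := forall n, n < 0 -> (v n).[- q] = 0.
suff: P (symb a) by apply.
have: P e0 by move=> j j0; rewrite /mono lt_eqF // horner0.
rewrite /symb; move: e0.
apply: (rho_ind (Q := fun f => forall v, P v -> P (f v))) => {n} //.
- by move=> v vP n n0; rewrite rho_x0 hornerM vP // mulr0.
- by move=> v vP n n0; rewrite rho_xp vP //; lia.
- move=> v vP n n0; rewrite rho_xm hornerM.
  have [->|n1] := eqVneq n (-1); last by rewrite vP ?mulr0 //; lia.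
  rewrite xm_coefE exprN1 !hornerE /= [X in X * _](_ : _ = 0) ?mul0r //.
  by field; rewrite q0.
- move=> c f h fP hP v vP n n0.
  rewrite [X in X.[_]](_ : _ = c *: f v n + h v n) // hornerD hornerZ.
  by rewrite fP // hP // mulr0 addr0.
- by move=> f h fP hP v /hP/fP.
Qed.

Lemma symb0 n : symb 0 n = 0.
Proof. by rewrite /symb raddf0. Qed.

Lemma symb_neq0 a : a != 0 -> exists n, symb a n != 0.
Proof.
move=> a0; apply: contra_notP (elimN eqP a0) => /forallNP H.
by apply: symb_inj => n; apply/eqP/negPn/negP/H.
Qed.

End Representation.

(** * Extremal degrees *)

Section Extremal.
Variables (k : fieldType) (q : k).
Hypothesis q0 : q != 0.
Local Notation w := (q ^+ 2).
Local Notation dil c := (comp_poly (c *: 'X)).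
Local Notation V := (int -> {poly k}).
Local Notation symb := (symb q0).
Local Notation rho := (rho q0).
Implicit Types (v : V) (g : {poly k}) (s n m : int).

(** N is the top degree of v for s = 1, and the bottom degree for s = -1. *)
Definition extremal (s : int) v N :=
  v N != 0 /\ forall n, 0 < s * (n - N) -> v n = 0.

Lemma extremal_exists s v n : s = 1 \/ s = -1 -> finsupp v -> v n != 0 ->
  exists N, extremal s v N.
Proof.
move=> sE [B vB] vn.
have nB : (`|n| <= B)%N by rewrite leqNgt; apply: contra vn => /vB ->.
pose P (i : nat) := v (s * (B%:Z - i%:Z)) != 0.
have exP : exists i, P i.
  exists (absz (B%:Z - s * n)%R); rewrite /P.
  by rewrite (_ : s * _ = n) //; case: sE => ->; lia.
have [i Pi mini] := ex_minnP exP.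
exists (s * (B%:Z - i%:Z)); split=> // m m_gt.
have [lt_Bm|le_mB] := ltnP B `|m|%N; first exact: vB.
have nE : m = s * (B%:Z - (absz (B%:Z - s * m)%R)%:Z).
  by case: sE m_gt => ->; lia.
apply/eqP; apply: contraT => vm.
have := mini (absz (B%:Z - s * m)%R).
rewrite /P -nE => /(_ vm); case: sE m_gt => ->; lia.
Qed.

Lemma extremal_uniq s v N M : s = 1 \/ s = -1 ->
  extremal s v N -> extremal s v M -> N = M.
Proof.
move=> sE [vN N0] [vM M0]; apply/eqP; rewrite eq_le.
have le1 : s * (N - M) <= 0.
  by rewrite leNgt; apply: contra vN => /M0->.
have le2 : s * (M - N) <= 0.
  by rewrite leNgt; apply: contra vM => /N0->.
by case: sE le1 le2 => ->; lia.
Qed.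

(** Extremal degrees add up, since the polynomials have no zero divisors. *)
Lemma extremal_rho s a v N M : s = 1 \/ s = -1 -> finsupp v ->
  extremal s (symb a) N -> extremal s v M -> extremal s (rho a v) (N + M).
Proof.
move=> sE vfin [aN a0] [vM v0].
have loc n : 0 <= s * (n - (N + M)) ->
    rho a v n = dil (w ^ M) (symb a (n - M)) * v M.
  move=> n_ge; apply: rho_local => // j jM vj; apply: a0.
  have : s * (j - M) <= 0 by rewrite leNgt; apply: contra vj => /v0->.
  by case: sE n_ge => ->; lia.
split=> [|n n_gt].
  rewrite loc ?subrr ?mulr0 // addrK mulf_neq0 // dil_eq0 //.
  exact: wX0.
rewrite loc ?ltW // a0 ?raddf0 ?mul0r //.
by rewrite -addrA -opprD [M + N]addrC.
Qed.

(** If b is homogeneous of degree D and b' c = c b, then b' is homogeneous of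
degree D too, because the top and bottom degrees of both sides agree. Then
the second conclusion compares the coefficients of degree n + D. *)
Lemma symb_intertwined D g b b' c : symb b = mono D g -> g != 0 ->
  c != 0 -> b' * c = c * b ->
  (forall n, n != D -> symb b' n = 0) /\
  forall n, dil (w ^ n) (symb b' D) * symb c n = dil (w ^ D) (symb c n) * g.
Proof.
move=> bE g0 c0 bc.
have cbE : rho b' (symb c) = rmul q D g (symb c).
  by rewrite -(symbM_mono _ bE) -bc /symb rhoM.
have [n0 cn0] := symb_neq0 q0 c0.
have b'0 : b' != 0.
  apply: contra_neq c0 => b'0; apply: (@symb_inj _ _ q0) => n.
  have /(congr1 (fun v => v (n + D))) := cbE.
  rewrite b'0 raddf0 /rmul addrK => /esym/eqP.
  by rewrite mulf_eq0 (negPf g0) orbF dil_eq0 ?wX0 // => /eqP.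
have [m0 bm0] := symb_neq0 q0 b'0.
have shift s N :
    extremal s (symb c) N -> extremal s (rmul q D g (symb c)) (N + D).
  move=> [cN cn]; split; rewrite /rmul.
    by rewrite addrK mulf_neq0 // dil_eq0 ?wX0.
  by move=> n Hn; rewrite cn ?raddf0 ?mul0r // -addrA -opprD [D + N]addrC.
have extD s : s = 1 \/ s = -1 -> extremal s (symb b') D.
  move=> sE; have [N cN] := extremal_exists sE (symb_finsupp q0 c) cn0.
  have [T bT] := extremal_exists sE (symb_finsupp q0 b') bm0.
  have := extremal_rho sE (symb_finsupp q0 c) bT cN; rewrite cbE.
  move/(extremal_uniq sE (shift _ _ cN)); rewrite addrC => /addIr ->.
  by [].
have sD n : n != D -> symb b' n = 0.
  move=> nD; have [_ H1] := extD 1 (or_introl erefl).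
  have [_ H2] := extD (-1) (or_intror erefl).
  have [lt_nD|lt_Dn|eq_nD] := ltgtP n D; last by rewrite eq_nD eqxx in nD.
    by apply: H2; lia.
  by apply: H1; lia.
split=> // n; have /(congr1 (fun v => v (n + D))) := cbE.
rewrite /rmul addrK => <-.
rewrite (rho_local (m := n) (symb_finsupp q0 c)) ?[n + D]addrC ?addrK //.
by move=> j jn _; apply: sD; lia.
Qed.

End Extremal.

(** * The twisted centre *)

Section TwistedCentre.
Variables (k : fieldType) (q : k).
Hypothesis q0 : q != 0.
Hypothesis hq : forall n : nat, (0 < n)%N -> q ^+ n != 1.
Local Notation w := (q ^+ 2).
Local Notation dil c := (comp_poly (c *: 'X)).
Local Notation symb := (symb q0).
Local Notation X0 := (x_ q i0).
Local Notation Xp := (x_ q ip1).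
Local Notation Xm := (x_ q im1).

Lemma wX_eq1 (n : int) : w ^ n = 1 -> n = 0.
Proof.
case: n => [[|n] //|n].
  by move=> /eqP; rewrite -exprnP -exprM (negPf (hq _)).
move=> /(congr1 (fun x => x^-1)).
rewrite -[w ^ _]/(w ^- n.+1) invrK invr1 => /eqP.
by rewrite -exprM (negPf (hq _)).
Qed.

Lemma wX_inj (n m : int) : w ^ n = w ^ m -> n = m.
Proof.
move=> e; apply/eqP; rewrite -subr_eq0; apply/eqP/wX_eq1.
by rewrite (wD q0) e -(wD q0) subrr.
Qed.

Lemma twcenter_x0_exp d : twcenter (sigma q (w ^+ d)) (X0 ^+ d).
Proof.
elim: d => [|d IH] b; first by rewrite !expr0 sigma1 mul1r mulr1.
rewrite !(exprSr _ d) -mulrA x0_twcenter // mulrA IH mulrA.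
by rewrite -(sigma_comp _ (l := w ^+ d) (m := w)) ?expf_neq0.
Qed.

(** The three generators are used in turn. If c has a nonzero coefficient in
degree n, then c x_0 = t(x_0) c forces t(x_0) to be q^(-2 n) h, so that c is
homogeneous, of degree N say. By c x_1 = t(x_1) c and a comparison of sizes, its
coefficient is multiplied by a constant when it is dilated by q^2, so that it is
a monomial. By c x_{-1} = t(x_{-1}) c, the root - q of the coefficient of
t(x_{-1}) gives the root - q^(1 - 2 N) of xm_coef (-1), whose only nonzero root
is - q, so that N = 0. Finally, c determines t because c is not a zero divisor. *)
Lemma twcenterE t (c : podles q) : twcenter t c -> c != 0 ->
  exists d beta, c = beta *: X0 ^+ d /\ t = sigma q (w ^+ d).
Proof.
move=> ct c0.
have [_ E0] :=
  symb_intertwined (symb_x0 q0) (negbT (polyX_eq0 k)) c0 (esym (ct X0)).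
have [_ E1] :=
  symb_intertwined (symb_xp q0) (oner_neq0 _) c0 (esym (ct Xp)).
have [_ E2] :=
  symb_intertwined (symb_xm q0) (xm_coef_neq0 q0 _) c0 (esym (ct Xm)).
have [N cN] := symb_neq0 q0 c0.
have homog n : n != N -> symb c n = 0.
  have tx0 m : symb c m != 0 -> symb (t X0) 0 = w ^ (- m) *: 'X.
    move=> cm; have := E0 m; rewrite expr0z dil1 mulrC => /(mulfI cm) e.
    have w1 : w ^ m * w ^ (- m) = 1 by rewrite -(wD q0) subrr.
    by rewrite -[LHS]dil1 -w1 -dilM e dilX.
  apply: contraNeq => cn; apply/eqP; apply: (@oppr_inj int).
  apply: wX_inj; have := tx0 _ cn; rewrite (tx0 _ cN).
  move/(congr1 (fun p : {poly k} => p`_1)).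
  by rewrite !coefZ coefX !mulr1 => ->.
have [d [beta cNE]] : exists d beta, symb c N = beta *: 'X^d.
  have /= := E1 N; rewrite mulr1 expr1z; move: (dil (w ^ N) _) => u uE.
  have u0 : u != 0.
    apply: contra_neq cN => u0; apply/eqP; rewrite -(dil_eq0 _ (w0 q0)).
    by rewrite -uE u0 mul0r.
  have : size u == 1%N.
    have := congr1 (fun p : {poly k} => size p) uE.
    rewrite size_mul // size_dil ?(w0 q0) //.
    move: u0 cN; rewrite -!size_poly_gt0.
    by move: (size u) (size (symb c N)) => i j; lia.
  (* every nonzero coefficient of index i forces w ^ i = al, hence one i only *)
  case/size_poly1P => al _ uC.
  have ev i : (symb c N)`_i != 0 -> al = w ^ i%:Z.
    move=> ci; have /(congr1 (fun p : {poly k} => p`_i)) := uE.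
    by rewrite uC coefCM coef_dil => /(mulIf ci).
  pose d := (size (symb c N)).-1; exists d, (symb c N)`_d.
  apply/polyP => i; rewrite coefZ coefXn.
  have [->|id] := eqVneq i d; first by rewrite mulr1.
  rewrite mulr0; apply/eqP; apply: contraTT isT => ci.
  have := ev i ci; rewrite (ev d) => [/wX_inj[] di|].
    by rewrite di eqxx in id.
  by rewrite -lead_coefE lead_coef_eq0.
have be0 : beta != 0.
  by apply: contra_neq cN => b0; rewrite cNE b0 scale0r.
have N0 : N = 0.
  (* y is the point that the dilation by w ^ N sends to the root - q *)
  have [y yE] : exists y, y = w ^ (- N) * - q by eexists.
  have y0 : y != 0 by rewrite yE mulf_neq0 ?(wX0 q0) ?oppr_eq0.
  have wy : w ^ N * y = - q by rewrite yE mulrA -(wD q0) subrr expr0z mul1r.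
  have /(congr1 (fun p => p.[y])) := E2 N; rewrite xm_coefE exprN1.
  rewrite !hornerM !horner_dil wy symb_root // mul0r cNE hornerZ hornerXn.
  move=> /esym/eqP; rewrite mulf_eq0 mulf_eq0 (negPf be0) expf_eq0 mulf_eq0.
  rewrite invr_eq0 (negPf (w0 q0)) (negPf y0) andbF /= => /eqP e.
  have /eqP : w^-1 * y * (y + q) = 0.
    by rewrite -[RHS]e !hornerE /=; field; rewrite q0.
  rewrite !mulf_eq0 invr_eq0 (negPf (w0 q0)) (negPf y0) /= addr_eq0 => /eqP.
  rewrite yE -[RHS]mul1r => /mulIf; rewrite oppr_eq0 => /(_ q0)/wX_eq1/eqP.
  by rewrite oppr_eq0 => /eqP.
subst N.
have cE : c = beta *: X0 ^+ d.
  apply/eqP; rewrite -subr_eq0; apply/eqP; apply: (@symb_inj _ _ q0) => n.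
  have -> : beta *: X0 ^+ d = horner_alg X0 (beta *: 'X^d).
    by rewrite linearZ /= rmorphXn /= horner_algX mulr_algl.
  rewrite -scaleN1r symbD symbZ symb_alg -cNE /mono.
  have [->|/homog->] := eqVneq n 0; last by rewrite scaler0 addr0.
  by rewrite scaleN1r subrr.
exists d, beta; split=> //; apply: funext => b.
apply/eqP; rewrite -subr_eq0; apply/eqP; apply: (@symb_inj _ _ q0) => n.
have : (t b - sigma q (w ^+ d) b) * c = 0.
  by rewrite mulrBl -ct cE -scalerAl -scalerAr (twcenter_x0_exp d b) subrr.
move=> /(congr1 (fun a => symb a n)).
rewrite (@symbM_mono _ _ q0 _ _ 0 (symb c 0)); last first.
  apply: funext => j; rewrite /mono.
  by have [->|/homog->] := eqVneq j 0.
rewrite symb0 /rmul subr0 expr0z dil1 => /eqP.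
by rewrite mulf_eq0 (negPf cN) orbF => /eqP.
Qed.

End TwistedCentre.

(** * Twisted homology in degree 0 *)

Lemma cls_mulC (k : fieldType) (A : algType k) (s : A -> A) (a b : A) :
  cls s (a * b) = cls s (s b * a).
Proof. by apply/lcls_eq/mem_lspan; exists a, b. Qed.

Section Homology.
Variables (k : fieldType) (q : k).
Hypothesis q0 : q != 0.
Hypothesis hq : forall n : nat, (0 < n)%N -> q ^+ n != 1.
Local Notation w := (q ^+ 2).
Local Notation X0 := (x_ q i0).
Local Notation Xp := (x_ q ip1).
Local Notation Xm := (x_ q im1).

Lemma wXn_neq1 (i : nat) : (0 < i)%N -> w ^+ i != 1.
Proof. by move=> i_gt0; rewrite -exprM hq // muln_gt0. Qed.

(** Moving one x_0 cyclically around the product fixes the class, as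
sigma_l x_0 = x_0, and multiplies the product by c^i. *)
Lemma cls_x0_mul_exp l m i y c : l != 0 -> X0 * y = c *: (y * X0) ->
  c ^+ i != 1 -> cls (sigma q l) (X0 ^+ m.+1 * y ^+ i) = 0.
Proof.
move=> l0 xy ci; set v := cls _ _.
have vE : v = cls (sigma q l) (X0 ^+ m * y ^+ i * X0).
  by rewrite [RHS]cls_mulC sigma_x // -[l ^ _]/(1 : k) scale1r mulrA -exprS.
have : v = c ^+ i *: v.
  rewrite {2}vE -linearZ /= -mulrA scalerAr -(skew_comm_exp _ xy).
  by rewrite mulrA -exprSr.
move/eqP; rewrite -subr_eq0 -{1}[v]scale1r -scalerBl scaler_eq0 subr_eq0.
by rewrite eq_sym (negPf ci) => /eqP.
Qed.

Lemma x0_xp : X0 * Xp = w *: (Xp * X0).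
Proof. by rewrite xp_x0 scalerA mulfV ?expf_neq0 ?scale1r. Qed.

Lemma x0_xm : X0 * Xm = w^-1 *: (Xm * X0).
Proof. by rewrite xm_x0 scalerA mulVf ?expf_neq0 ?scale1r. Qed.

Lemma cls_x0_xp l m i : l != 0 -> (0 < i)%N ->
  cls (sigma q l) (X0 ^+ m.+1 * Xp ^+ i) = 0.
Proof.
move=> l0 i_gt0; apply: (cls_x0_mul_exp _ l0 x0_xp).
exact: wXn_neq1.
Qed.

Lemma cls_x0_xm l m i : l != 0 -> (0 < i)%N ->
  cls (sigma q l) (X0 ^+ m.+1 * Xm ^+ i) = 0.
Proof.
move=> l0 i_gt0; apply: (cls_x0_mul_exp _ l0 x0_xm).
by rewrite exprVn invr_eq1 wXn_neq1.
Qed.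

(** H_0 is spanned by the classes of the powers of the generators: by the
preceding lemmas, the mixed monomials have class 0. *)
Lemma H0_linear_eq l (W : lmodType k) (f g : H0 (sigma q l) -> W) : l != 0 ->
  linear f -> linear g ->
  (forall n, f (cls (sigma q l) (X0 ^+ n)) = g (cls (sigma q l) (X0 ^+ n))) ->
  (forall j, (0 < j)%N ->
     f (cls (sigma q l) (Xp ^+ j)) = g (cls (sigma q l) (Xp ^+ j))) ->
  (forall j, (0 < j)%N ->
     f (cls (sigma q l) (Xm ^+ j)) = g (cls (sigma q l) (Xm ^+ j))) ->
  forall h, f h = g h.
Proof.
move=> l0 fL gL e0 ep em h.
have f0 : f 0 = g 0 by rewrite !linear_at0.
have mixed y :
    (forall m i, (0 < i)%N -> cls (sigma q l) (X0 ^+ m.+1 * y ^+ i) = 0) ->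
    (forall j, (0 < j)%N ->
       f (cls (sigma q l) (y ^+ j)) = g (cls (sigma q l) (y ^+ j))) ->
    forall m i, f (cls (sigma q l) (X0 ^+ m * y ^+ i)) =
                g (cls (sigma q l) (X0 ^+ m * y ^+ i)).
  move=> y0 ey m [|i]; first by rewrite expr0 mulr1.
  case: m => [|m]; first by rewrite expr0 mul1r ey.
  by rewrite y0.
rewrite -[h]cls_surj; move: (repr h) (pbw_span (repr h)).
apply: lspan_ind => [|c _ b [m [i [->|->]]] IH]; first by rewrite raddf0.
  rewrite linearP /= fL gL IH mixed // => m' i'; exact: cls_x0_xp.
rewrite linearP /= fL gL IH mixed // => m' i'; exact: cls_x0_xm.
Qed.

(** The classes of x_0^j x_{-1} x_1 and of sigma_l(x_1) x_0^j x_{-1} agree, and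
both products are polynomials in x_0. *)
Lemma cls_x0_rec l j : l != 0 ->
  (w * (1 - l / w ^+ j.+2)) *: cls (sigma q l) (X0 ^+ j.+2) +
  (q * (1 - l / w ^+ j.+1)) *: cls (sigma q l) (X0 ^+ j.+1) = 0.
Proof.
move=> l0.
have E2 : X0 ^+ j * X0 ^+ 2 = X0 ^+ j.+2 by rewrite -exprD addn2.
have E1 : X0 ^+ j * X0 = X0 ^+ j.+1 by rewrite exprSr.
have lE : l ^ (ip1%:Z - 1) = l by [].
have := cls_mulC (sigma q l) (X0 ^+ j * Xm) Xp.
rewrite -mulrA xm_xp sigma_x // lE mulrA -scalerAl (skew_comm_exp _ (xp_x0 q)).
rewrite -!scalerAl -mulrA xp_xm !mulrDr -!scalerAr E1 E2.
rewrite scalerA scalerDr !scalerA !linearD !linearZ /= => /eqP.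
rewrite -subr_eq0 opprD addrACA -!scalerBl => /eqP e.
by rewrite -[RHS]e; congr (_ *: _ + _ *: _);
  rewrite exprVn !(exprS w); field; rewrite q0 expf_neq0 ?expf_neq0.
Qed.

(** In the recursion between [x_0^(j + 2)] and [x_0^(j + 1)], the higher power
has the coefficient 0 for j + 1 = m, which kills [x_0^m]; the coefficient of the
lower power is invertible for all j < m, which leads down to [x_0]. *)
Lemma cls_x0_eq0 m : (0 < m)%N -> cls (sigma q (w * q ^+ (2 * m))) X0 = 0.
Proof.
case: m => // m _; rewrite exprM -exprS; set l := w ^+ _.
have l0 : l != 0 by rewrite expf_neq0 // expf_neq0.
suff H j : (j <= m)%N -> cls (sigma q l) (X0 ^+ (m - j).+1) = 0.
  by rewrite -[X0]expr1 -[1%N]/(0.+1) -(subnn m) H.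
elim: j => [_|j IH jm].
  have := cls_x0_rec m l0; rewrite subn0 mulfV // subrr mulr0 scale0r add0r.
  move/eqP; rewrite scaler_eq0 mulf_eq0 (negPf q0) /= /l exprS.
  by rewrite mulfK ?expf_neq0 // subr_eq0 eq_sym (negPf (hq _)) // => /eqP.
have := cls_x0_rec (m - j.+1) l0; rewrite -subSn // subSS IH; last exact: ltnW.
rewrite scaler0 add0r => /eqP; rewrite scaler_eq0 mulf_eq0 (negPf q0) /=.
rewrite subr_eq0 eq_sym /l -expfB; last by lia.
by rewrite (negPf (wXn_neq1 _)) => [/eqP|]; last by lia.
Qed.

Lemma cls_x0_sqr l : l != 0 -> l != w ->
  cls (sigma q (w * l)) (X0 ^+ 2) =
  (- q * ((1 - l) / (w - l))) *: cls (sigma q (w * l)) X0.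
Proof.
move=> l0 lw; have w0 : w != 0 by rewrite expf_neq0.
have := cls_x0_rec 0 (mulf_neq0 w0 l0).
rewrite expr1 => /eqP; rewrite addr_eq0 => /eqP e.
have wl : w - l != 0 by rewrite subr_eq0 eq_sym.
apply: (scalerI wl).
have -> : w - l = w * (1 - w * l / w ^+ 2) by field; rewrite q0.
rewrite e -scaleNr scalerA; congr (_ *: _).
by field; rewrite q0 wl.
Qed.

End Homology.

(** * The cap product *)

Lemma twcenter_action0 (k : fieldType) (A : algType k)
    (act : forall s r : A -> A, A -> H0 s -> H0 r) s t h :
  twcenter_action act -> is_algaut s -> is_algaut t -> act s (t \o s) 0 h = 0.
Proof.
move=> [_ actD _ _] sA tA.
have z : twcenter t 0 by move=> b; rewrite mulr0 mul0r.
have := actD s t 1 0 0 h sA tA z z.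
by rewrite !scale1r addr0 -[X in X = _]addr0 => /addrI<-.
Qed.

Section CapProduct.
Variables (k : fieldType) (q : k).
Hypothesis q0 : q != 0.
Hypothesis hq : forall n : nat, (0 < n)%N -> q ^+ n != 1.
Local Notation w := (q ^+ 2).
Local Notation X0 := (x_ q i0).

Lemma cap_x0_formulas l : l != 0 ->
  x0_action_formulas (@cap _ _ (sigma q l) (sigma q (w * l)) X0).
Proof.
move=> l0; have w0 : w != 0 by rewrite expf_neq0.
have wl0 := mulf_neq0 w0 l0.
have capE a : cap (sigma q (w * l)) X0 (cls (sigma q l) a) =
    cls (sigma q (w * l)) (X0 * a).
  by apply: (cap_cls a (x0_twcenter q0)); rewrite sigma_comp.
split=> [j j_gt0|j j_gt0|n]; rewrite capE; last by rewrite -exprS.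
  by rewrite -[X0]expr1 cls_x0_xp.
by rewrite -[X0]expr1 cls_x0_xm.
Qed.

(** As the twisted centre is spanned by the powers of x_0, and H_0 by the
classes that the formulas speak of, the formulas leave no freedom: x_0 acts as
prescribed, x_0^d by iteration, and multiples by linearity. *)
Lemma twcenter_action_unique
    (act : forall s r : podles q -> podles q, podles q -> H0 s -> H0 r) :
  twcenter_action act ->
  (forall m, m != 0 ->
     x0_action_formulas (act (sigma q m) (sigma q (w * m)) X0)) ->
  forall l t c, l != 0 -> is_algaut t -> twcenter t c ->
  forall h : H0 (sigma q l),
    act (sigma q l) (t \o sigma q l) c h = cap (t \o sigma q l) c h.
Proof.
move=> actA actF l t c l0 tA ct h; have [actL actC act1 actM] := actA.
have [capL capC cap1 capM] := cap_twcenter_action (podles q).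
have w0 : w != 0 by rewrite expf_neq0.
have act_x0 m x : m != 0 ->
    act (sigma q m) (sigma q w \o sigma q m) X0 x =
    cap (sigma q w \o sigma q m) X0 x.
  move=> m0; move: x.
  have wA := sigma_algaut q w0; have mA := sigma_algaut q m0.
  have := actL _ _ _ mA wA (x0_twcenter q0).
  have := capL _ _ _ mA wA (x0_twcenter q0).
  rewrite sigma_comp // => cL aL.
  have [ap am a0] := actF m m0; have [cp cm c0] := cap_x0_formulas m0.
  apply: (H0_linear_eq q0 hq m0 aL cL) => [n|j j0|j j0].
  - by rewrite a0 c0.
  - by rewrite ap ?cp.
  - by rewrite am ?cm.
have lA := sigma_algaut q l0.
have act_exp d x : act (sigma q l) (sigma q (w ^+ d) \o sigma q l) (X0 ^+ d) x =
    cap (sigma q (w ^+ d) \o sigma q l) (X0 ^+ d) x.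
  elim: d => [|d IH].
    by rewrite !expr0 sigma1 act1 // cap1.
  have wd0 : w ^+ d != 0 by rewrite expf_neq0.
  have -> : sigma q (w ^+ d.+1) \o sigma q l =
      sigma q w \o (sigma q (w ^+ d) \o sigma q l).
    by rewrite !sigma_comp ?mulf_neq0 ?expf_neq0 // mulrA -exprS.
  have wdA := sigma_algaut q wd0; have wA := sigma_algaut q w0.
  have xd := twcenter_x0_exp q0 d; have x1 := x0_twcenter q0.
  rewrite (exprS X0) actM // capM // IH sigma_comp //.
  by rewrite act_x0 // mulf_neq0.
have [->|c0] := eqVneq c 0.
  by rewrite !twcenter_action0 //; apply: cap_twcenter_action.
have [d [beta [-> ->]]] := twcenterE q0 hq ct c0.
have wdA : is_algaut (sigma q (w ^+ d)).
  by apply: sigma_algaut; rewrite expf_neq0.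
have xd := twcenter_x0_exp q0 d.
have z : twcenter (sigma q (w ^+ d)) 0 by move=> b; rewrite mulr0 mul0r.
by rewrite -[_ *: _]addr0 actC // capC // act_exp !twcenter_action0.
Qed.

End CapProduct.

Theorem lemma8p2 (R : realType) (q : R[i]) (hq0 : q != 0)
    (hq : forall n : nat, (0 < n)%N -> q ^+ n != 1)
    (l : R[i]) (hl : l != 0) :
  [/\ x0_action_formulas
        (@cap _ _ (sigma q l) (sigma q (q ^+ 2 * l)) (x_ q i0)),
      forall m : nat, (0 < m)%N -> l = q ^+ (2 * m) ->
        cls (sigma q (q ^+ 2 * l)) (x_ q i0) = 0,
      l != q ^+ 2 ->
        cls (sigma q (q ^+ 2 * l)) (x_ q i0 ^+ 2) =
        (- q * ((1 - l) / (q ^+ 2 - l))) *: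
          cls (sigma q (q ^+ 2 * l)) (x_ q i0)
    & forall act : forall s r : podles q -> podles q,
          podles q -> H0 s -> H0 r,
        twcenter_action act ->
        (forall m : R[i], m != 0 ->
           x0_action_formulas
             (act (sigma q m) (sigma q (q ^+ 2 * m)) (x_ q i0))) ->
        forall (t : podles q -> podles q) (c : podles q),
          is_algaut t -> twcenter t c ->
          forall h : H0 (sigma q l),
            act (sigma q l) (t \o sigma q l) c h =
            cap (t \o sigma q l) c h].
Proof.
split.
- exact: cap_x0_formulas.
- by move=> m m_gt0 ->; apply: cls_x0_eq0.
- exact: cls_x0_sqr.
- by move=> act actA actF t c tA ct; apply: twcenter_action_unique.
Qed.
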